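(* Let $(\Omega,\preceq)$ be a totally preordered space with smallest element $0_\Omega$ and largest element $1_\Omega$, assume that $\Omega/\simeq$ is order complete, and let $(\underline F,\overline F)$ be a p-box on $(\Omega,\preceq)$. Then $(\underline F,\overline F)$ is a possibility measure if and only if either (L1) $\underline F$ is $0$–$1$-valued, (L2) $\overline F(x)=\overline F(x-)$ for all $x\in\Omega$ that have no immediate predecessor, and (L3) $\{x\in\Omega^*:\underline F(x)=1\}$ has a minimum, or (U1) $\overline F$ is $0$–$1$-valued, (U2) $\underline F(x)=\underline F(x+)$ for all $x\in\Omega$ that have no immediate successor, and (U3) $\{x\in\Omega^*:\overline F(x)=0\}$ has a maximum.
   Context: A total preorder $\preceq$ is reflexive, transitive, with any two elements comparable; $x\prec y$ means $x\preceq y$ and not $y\preceq x$; $x\simeq y$ means $x\preceq y$ and $y\preceq x$; $\Omega/\simeq$ is the quotient with its induced total order, and it is order complete if every subset has a supremum and an infimum. A formal element $0_\Omega-$ is added: $\Omega^*=\Omega\cup\{0_\Omega-\}$ with $0_\Omega-\prec x$ for all $x\in\Omega$. Suprema, infima, maxima, minima of sets are with respect to the preorder (hence unique up to $\simeq$). A cumulative distribution function is a non-decreasing map $F:\Omega\to[0,1]$ with $F(1_\Omega)=1$, extended to $\Omega^*$ by $F(0_\Omega-)=0$. A p-box is a pair $(\underline F,\overline F)$ of cumulative distribution functions with $\underline F\le\overline F$. $F$ is $0$–$1$-valued if it takes only the values $0$ and $1$. For $x\in\Omega$, $F(x-)=\sup_{z\in\Omega^*,\,z\prec x}F(z)$ and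 $F(x+)=\inf_{z\in\Omega,\,z\succ x}F(z)$ (infimum of the empty set equal to $1$, so $F(1_\Omega+)=1$). An immediate predecessor of $x\in\Omega$ is a $y\in\Omega^*$ with $y\prec x$ and no $z\in\Omega^*$ with $y\prec z\prec x$ (so $0_\Omega-$ is an immediate predecessor of $0_\Omega$); immediate successors are defined analogously. The natural extension of the p-box is $\overline E_{\underline F,\overline F}(A)=\sup P(A)$ for $A\subseteq\Omega$, the supremum being over all finitely additive probabilities $P$ on the power set of $\Omega$ with $\underline F(x)\le P([0_\Omega,x])\le\overline F(x)$ for all $x\in\Omega$, where $[0_\Omega,x]=\{z\in\Omega: z\preceq x\}$. The p-box $(\underline F,\overline F)$ ''is a possibility measure'' if $\overline E_{\underline F,\overline F}(A)=\sup_{x\in A}\overline E_{\underline F,\overline F}(\{x\})$ for all $A\subseteq\Omega$ (with $\sup\emptyset=0$). *)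

(* Defs.v *)
From HB Require Import structures.
From mathcomp Require Import all_boot all_order all_algebra generic_quotient.
From mathcomp Require Import boolp classical_sets reals.

Set Implicit Arguments.
Unset Strict Implicit.
Unset Printing Implicit Defensive.

Import Order.Theory GRing.Theory Num.Theory.

Local Open Scope classical_set_scope.
Local Open Scope ring_scope.
Local Open Scope quotient_scope.

Section quotient.
Context {d : Order.disp_t} {T : preorderType d}.

Definition peq (x y : T) : bool := ((x <= y) && (y <= x))%O.

Lemma peq_refl : reflexive peq.
Proof. by move=> x; rewrite /peq lexx. Qed.

Lemma peq_sym : symmetric peq.
Proof. by move=> x y; rewrite /peq andbC. Qed.

Lemma peq_trans : transitive peq.
Proof.
move=> y x z /andP[xy yx] /andP[yz zy].
by rewrite /peq (le_trans xy yz) (le_trans zy yx).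
Qed.

Canonical peq_equiv := EquivRel peq peq_refl peq_sym peq_trans.

Definition pquot := {eq_quot peq}.

HB.instance Definition _ := Choice.on pquot.
HB.instance Definition _ := EqQuotient.on pquot.

Definition pquot_le (a b : pquot) : bool := (repr a <= repr b)%O.

Lemma pquot_le_refl : reflexive pquot_le.
Proof. by move=> a; rewrite /pquot_le lexx. Qed.

Lemma pquot_le_anti : antisymmetric pquot_le.
Proof.
by move=> a b ab; rewrite -[a]reprK -[b]reprK; exact/eqquotP.
Qed.

Lemma pquot_le_trans : transitive pquot_le.
Proof. by move=> b a c; rewrite /pquot_le; exact: le_trans. Qed.

HB.instance Definition _ := Order.Le_isPOrder.Build d pquot
  pquot_le_refl pquot_le_anti pquot_le_trans.

(* The order on the quotient does not depend on the chosen representatives. *)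
Lemma pquot_leE (x y : T) :
  ((\pi_pquot x : pquot) <= (\pi_pquot y : pquot))%O = (x <= y)%O.
Proof.
have peqr z : peq (repr (\pi_pquot z : pquot)) z.
  by rewrite -[peq _ _]/(peq_equiv _ _); apply/eqmodP; rewrite reprK.
have /andP[rx xr] := peqr x; have /andP[ry yr] := peqr y.
rewrite -[LHS]/(pquot_le _ _) /pquot_le; apply/idP/idP => h.
  exact: le_trans xr (le_trans h ry).
exact: le_trans rx (le_trans h yr).
Qed.

End quotient.
Arguments pquot {d} T.

Definition order_complete d (T : porderType d) : Prop :=
  forall A : set T, supremums A !=set0 /\ infimums A !=set0.

(* T with a new element [None] strictly below every element of T. *)
Definition adjoin_bot (T : Type) : Type := option T.

Section adjoin_bot.
Context {d : Order.disp_t} {T : preorderType d}.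

HB.instance Definition _ := Choice.copy (adjoin_bot T) (option T).

Definition adjoin_bot_le (x y : adjoin_bot T) : bool :=
  match x, y with
  | None, _ => true
  | Some _, None => false
  | Some x, Some y => (x <= y)%O
  end.

Lemma adjoin_bot_le_refl : reflexive adjoin_bot_le.
Proof. by case=> //= x; exact: lexx. Qed.

Lemma adjoin_bot_le_trans : transitive adjoin_bot_le.
Proof. by move=> [y|] [x|] [z|] //=; rewrite /adjoin_bot_le; exact: le_trans. Qed.

HB.instance Definition _ := Order.Le_isPreorder.Build d (adjoin_bot T)
  adjoin_bot_le_refl adjoin_bot_le_trans.

Lemma adjoin_bot_ltE (x y : T) :
  ((Some x : adjoin_bot T) < Some y)%O = (x < y)%O.
Proof. by rewrite !lt_leAnge. Qed.

Lemma adjoin_bot_lt0x (x : T) : ((None : adjoin_bot T) < Some x)%O.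
Proof. by rewrite lt_leAnge. Qed.

End adjoin_bot.

Definition has_minimum d (T : preorderType d) (A : set T) : Prop :=
  exists2 m, A m & forall x, A x -> (m <= x)%O.

Definition has_maximum d (T : preorderType d) (A : set T) : Prop :=
  exists2 m, A m & forall x, A x -> (x <= m)%O.

Definition immediately_below d (T : preorderType d) (y x : T) : Prop :=
  (y < x)%O /\ ~ exists z : T, (y < z)%O /\ (z < x)%O.

Definition has_immediate_pred d (T : preorderType d) (x : T) : Prop :=
  exists y : adjoin_bot T, immediately_below y (Some x).

Definition has_immediate_succ d (T : preorderType d) (x : T) : Prop :=
  exists y : T, immediately_below x y.

Section pbox.
Context {d : Order.disp_t} {T : tbPreorderType d} {R : realType}.
Implicit Types (F Fl Fu : T -> R).

Definition is_cdf F : Prop :=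
  [/\ (forall x, 0 <= F x <= 1),
      (forall x y, (x <= y)%O -> F x <= F y) &
      F \top%O = 1].

Definition cdf_ext F (x : adjoin_bot T) : R := if x is Some y then F y else 0.

Definition is_pbox Fl Fu : Prop :=
  [/\ is_cdf Fl, is_cdf Fu & forall x, Fl x <= Fu x].

Definition zero_one_valued F : Prop := forall x, F x = 0 \/ F x = 1.

Definition cdf_left F (x : T) : R :=
  sup [set cdf_ext F z | z in [set z : adjoin_bot T | (z < Some x)%O]].

(* The infimum of the empty set is 1 here, whereas [inf set0 = 0]. *)
Definition cdf_right F (x : T) : R :=
  if pselect (exists z, (x < z)%O) then inf [set F z | z in [set z | (x < z)%O]]
  else 1.

Definition fin_add_prob (P : set T -> R) : Prop :=
  [/\ (forall A, 0 <= P A), P setT = 1 &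
      forall A B, A `&` B = set0 -> P (A `|` B) = P A + P B].

Definition credal_set Fl Fu : set (set T -> R) :=
  [set P | fin_add_prob P /\
    forall x, Fl x <= P [set z | (z <= x)%O] <= Fu x].

Definition natural_ext Fl Fu (A : set T) : R :=
  sup [set P A | P in credal_set Fl Fu].

(* For A empty the right-hand side is [sup set0 = 0]. *)
Definition is_possibility_measure Fl Fu : Prop :=
  forall A : set T,
    natural_ext Fl Fu A = sup [set natural_ext Fl Fu [set x] | x in A].

End pbox.

(* Main.v *)
(* Every cumulative distribution function F is realised by a finitely additive
   probability: a 0-1-valued one is an ultrafilter, and a general F is an
   ultralimit over n of averages of the 0-1-valued functions [k / n < F x].
   If Fl is the indicator of [m, 1], the upper probability of A is at most
   Fu (sup (A `&` [0, m])), and this value is reached, or by (L2) approached, by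
   two-point measures at a point of A and at m; the case of Fu is similar, with
   1 - Fl at inf (A `&` {Fu = 1}).
   Conversely, the singletons below y and above x have upper probability at most
   Fu y and 1 - Fl x.  For a possibility measure this bounds P A by a maximum,
   where a suitable P in the credal set reaches a sum; comparing the two on
   A = [0, y] `|` (x, 1] gives (L1) or (U1).  The other conditions come from
   A = (x, 1] and A = [0, y), with P concentrated arbitrarily close below y. *)
Require Import Defs.
From mathcomp Require Import all_boot all_order all_algebra.
From mathcomp Require Import boolp classical_sets reals.
From mathcomp Require Import filter topology normedtype sequences lra.

Set Implicit Arguments.
Unset Strict Implicit.
Unset Printing Implicit Defensive.

Import Order.Theory GRing.Theory Num.Theory.
Import numFieldNormedType.Exports.

Local Open Scope classical_set_scope.
Local Open Scope ring_scope.

(** * Finitely additive probabilities, and their construction by ultrafilters and ultralimits *)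

Section charge.
Context {d : Order.disp_t} {T : tbPreorderType d} {R : realType}.
Implicit Types (P Q : set T -> R) (A B : set T).

Lemma fin_add_prob0 P : fin_add_prob P -> P set0 = 0.
Proof.
by case=> _ _ add; have := add set0 set0 (setI0 _); rewrite setU0; lra.
Qed.

Lemma fin_add_prob_le P A B : fin_add_prob P -> A `<=` B -> P A <= P B.
Proof.
case=> P0 _ add AB; rewrite -(setDUK AB) add ?lerDl ?P0//.
by rewrite setIDA setIC -setIDA setDv setI0.
Qed.

Lemma fin_add_probC P A : fin_add_prob P -> P (~` A) = 1 - P A.
Proof.
by case=> _ P1 add; have := add A (~` A) (setICr _); rewrite setUCr P1; lra.
Qed.

Lemma fin_add_prob_leD P A B C : fin_add_prob P -> A `<=` B `|` C ->
  P A <= P B + P C.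
Proof.
move=> hP ABC; have [_ _ add] := hP.
rewrite (le_trans (fin_add_prob_le hP ABC))// -(setDUK (@subsetUl _ B C)).
rewrite add ?lerD2l; last by rewrite setIDA setIC -setIDA setDv setI0.
by apply: fin_add_prob_le => // z [[]].
Qed.

Lemma fin_add_prob_le1 P A : fin_add_prob P -> P A <= 1.
Proof. by move=> hP; have [_ <- _] := hP; exact: fin_add_prob_le. Qed.

Lemma fin_add_prob_mix P Q (a : R) : 0 <= a <= 1 ->
  fin_add_prob P -> fin_add_prob Q ->
  fin_add_prob (fun A => a * P A + (1 - a) * Q A).
Proof.
move=> /andP[a0 a1] [P0 P1 PD] [Q0 Q1 QD]; split=> [A||A B AB].
- by rewrite addr_ge0 ?mulr_ge0 ?subr_ge0.
- by rewrite P1 Q1; lra.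
- by rewrite PD ?QD//; lra.
Qed.

Lemma fin_add_prob_dirac (x : T) : fin_add_prob (fun A => (`[< A x >])%:R : R).
Proof.
split=> [A||A B AB]; first exact: ler0n.
- by rewrite asboolT.
have ABx : ~ (A x /\ B x) by move=> h; have : set0 x by rewrite -AB.
case: (asboolP (A x)) => Ax; case: (asboolP (B x)) => Bx.
- by case: ABx.
- by rewrite asboolT ?addr0//; left.
- by rewrite asboolT ?add0r//; right.
- by rewrite asboolF ?addr0//; case.
Qed.

(** Totality makes the [r]-tails of [D] a filter base, and reflexivity keeps them nonempty. The
    membership indicator of an ultrafilter containing them is additive. *)
Lemma fin_add_prob_tail (r : rel T) (D : set T) :
    D !=set0 -> reflexive r -> transitive r -> total r ->
  exists2 P : set T -> R, fin_add_prob P &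
    forall x, D x -> P [set z | D z /\ r x z] = 1.
Proof.
move=> D0 rr rt rtot.
pose G : set_system T :=
  [set A | exists2 x, D x & [set z | D z /\ r x z] `<=` A].
have GF : ProperFilter G.
  apply: Build_ProperFilter_ex.
    by move=> A [x Dx xA]; exists x; apply: xA.
  split.
  - by case: D0 => x Dx; exists x.
  - move=> A B [x Dx xA] [y Dy yB].
    case/orP: (rtot x y) => xy.
      exists y => // z [Dz yz]; split; last exact: yB.
      by apply: xA; split=> //; exact: rt yz.
    exists x => // z [Dz xz]; split; first exact: xA.
    by apply: yB; split=> //; exact: rt xz.
  - by move=> A B AB [x Dx xA]; exists x => //; exact: subset_trans AB.
have [U [UU GU]] := ultraFilterLemma GF.
have UF := @ultra_proper _ _ UU.
exists (fun A => (`[< U A >])%:R); last first.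
  by move=> x Dx; rewrite asboolT//; apply: GU; exists x.
split=> [A||A B AB]; first exact: ler0n.
- by rewrite asboolT//; exact: filterT.
case: (asboolP (U A)) => UA.
  rewrite asboolT; last by apply: filterS UA => x; left.
  rewrite asboolF ?addr0// => UB.
  by apply: (@filter_not_empty _ U); rewrite -AB; exact: filterI.
case: (asboolP (U B)) => UB.
  by rewrite asboolT ?add0r//; apply: filterS UB => x; right.
rewrite asboolF ?addr0// => UAB.
have [//|UA'] := in_ultra_setVsetC A UU.
by apply: UB; apply: filterS (filterI UAB UA') => x [[]].
Qed.

(** Along an ultrafilter finer than the eventual filter, each sequence [P n A] converges by
    compactness of [0, 1]; the axioms pass to the limit, and ordinary limits are kept. *)
Lemma fin_add_prob_ultralimit (P : nat -> set T -> R) :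
    (forall n, fin_add_prob (P n)) ->
  exists2 Q, fin_add_prob Q &
    forall A (l : R), P^~ A @ \oo --> l -> Q A = l.
Proof.
move=> hP.
have [V [VU ooV]] := ultraFilterLemma (eventually_filter).
have VF := @ultra_proper _ _ VU.
have lim A : exists l : R, P^~ A @ V --> l.
  have [|l [_ cl]] := @segment_compact R 0 1 (P^~ A @ V) _.
    apply: nearW => n /=; rewrite in_itv /=.
    by have [-> _ _] := hP n; rewrite fin_add_prob_le1.
  exists l => B lB.
  have [//|VB] := in_ultra_setVsetC (P^~ A @^-1` B) VU.
  by have [x [nBx Bx]] := cl (~` B) B VB lB.
have [Q QP] := choice lim.
have uniq A (l : R) : P^~ A @ V --> l -> Q A = l.
  by apply: (cvg_unique _ (QP A)); exact: Rhausdorff.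
exists Q; last first.
  by move=> A l Pl; apply: uniq; apply: cvg_trans Pl => B; exact: ooV.
split=> [A||A B AB].
- by apply: (cvgr_to_ge (QP A)); apply: nearW => n; have [->] := hP n.
- apply: uniq; rewrite (_ : P^~ setT = fun=> 1); first exact: cvg_cst.
  by apply/funext => n; have [] := hP n.
- apply: uniq; rewrite (_ : P^~ (A `|` B) = P^~ A \+ P^~ B).
    exact: cvgD (QP A) (QP B).
  by apply/funext => n; have [_ _] := hP n; exact.
Qed.

(** * Realising a cumulative distribution function *)

Lemma sum_lt_bounds (n : nat) (r : R) : 0 <= r <= n%:R ->
  r <= \sum_(0 <= k < n) ((k%:R < r)%R%:R : R) <= r + 1.
Proof.
move=> /andP[r0 rn].
(* The hypothesis [r <= n] does not survive induction on [n], so the lower bound becomes min(n, r).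
   The bound by [n] yields the bound by [r + 1] when a new term 1 appears. *)
suff : [/\ \sum_(0 <= k < n) ((k%:R < r)%R%:R : R) <= n%:R,
    \sum_(0 <= k < n) ((k%:R < r)%R%:R : R) <= r + 1 &
    (n%:R <= \sum_(0 <= k < n) ((k%:R < r)%R%:R : R)) \/
    (r <= \sum_(0 <= k < n) ((k%:R < r)%R%:R : R))].
  by case=> _ -> [|->//]; rewrite andbT; exact: le_trans.
elim: n {rn} => [|n [hn hr hmin]].
  by rewrite big_nil; split=> //; [lra|left].
rewrite big_nat_recr//= -natr1; case: (ltP n%:R r) => nr /=.
  by split; [lra|lra|left; case: hmin; lra].
by split; [lra|lra|right; case: hmin; lra].
Qed.

Lemma fin_add_prob_avg (n : nat) (P : nat -> set T -> R) :
  (forall k, (k < n.+1)%N -> fin_add_prob (P k)) ->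
  fin_add_prob (fun A => n.+1%:R^-1 * \sum_(0 <= k < n.+1) P k A).
Proof.
move=> hP; split=> [A||A B AB].
- rewrite mulr_ge0 ?invr_ge0 ?ler0n// big_nat_cond sumr_ge0// => k.
  by rewrite andbT => /hP[].
- rewrite big_nat (eq_bigr (fun=> 1)) => [|k /hP[]//].
  by rewrite -big_nat big_const_nat subn0 iter_addr_0 mulVf ?pnatr_eq0.
- rewrite -mulrDr -big_split/= big_nat [in RHS]big_nat; congr (_ * _).
  by apply: eq_bigr => k /hP[_ _ ->].
Qed.

Context (le_total : total (<=%O : rel T)).

Lemma total_ltNge (x y : T) : (x < y)%O = ~~ (y <= x)%O.
Proof.
by rewrite lt_leAnge; case/orP: (le_total x y) => -> //=; rewrite andbF.
Qed.

(** The mass sits at the lower end of the up-set {t < F}, attained or not: the tails are taken for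
    the reversed order. *)
Lemma fin_add_prob_level (F : T -> R) (t : R) : is_cdf F -> t < 1 ->
  exists2 P : set T -> R, fin_add_prob P &
    forall x, P [set z | (z <= x)%O] = (t < F x)%R%:R.
Proof.
move=> [_ F_le F1] t1.
have [||||P hP PD] :=
  @fin_add_prob_tail (fun x y => (y <= x)%O) [set z | t < F z].
- by exists \top%O; rewrite /= F1.
- by move=> x /=; exact: lexx.
- by move=> y x z /= yx zy; exact: le_trans zy yx.
- by move=> x y /=; exact: le_total.
exists P => // x; have Ple1 A := fin_add_prob_le1 A hP.
case: (ltP t (F x)) => tx /=.
  by apply/le_anti; rewrite Ple1/= -(PD x)//; apply: fin_add_prob_le => // z [].
have := PD \top%O; rewrite /= F1 => /(_ t1) PD1.
apply/le_anti; have [-> _ _] := hP; rewrite andbT.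
suff : 1 <= P (~` [set z | (z <= x)%O]) by rewrite fin_add_probC//; lra.
rewrite -PD1; apply: fin_add_prob_le => // z [tz _] /= zx.
by move: (F_le _ _ zx); lra.
Qed.

(** Discretised layer-cake formula: F x is the integral over t in [0, 1] of the indicator of t < F
    x. Level charges at t = k/(n+1) are averaged over k, then an ultralimit in n is taken. *)
Lemma fin_add_prob_cdf (F : T -> R) : is_cdf F ->
  exists2 P : set T -> R, fin_add_prob P &
    forall x, P [set z | (z <= x)%O] = F x.
Proof.
move=> hF; have [F01 _ _] := hF.
have level n k : exists P : set T -> R, (k < n.+1)%N -> fin_add_prob P /\
    forall x, P [set z | (z <= x)%O] = (k%:R < F x * n.+1%:R)%R%:R.
  (* For k > n the zero function is a dummy value that lets [choice] range over all pairs (n, k). *)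
  case: ltnP => kn; last by exists (fun=> 0).
  have [|P hP PE] := @fin_add_prob_level F (k%:R / n.+1%:R) hF.
    by rewrite ltr_pdivrMr// mul1r ltr_nat.
  by exists P => _; split=> // x; rewrite PE ltr_pdivrMr.
have [P hP] := choice (fun nk : nat * nat => level nk.1 nk.2).
have [|Q hQ QE] := @fin_add_prob_ultralimit
    (fun n A => n.+1%:R^-1 * \sum_(0 <= k < n.+1) P (n, k) A).
  by move=> n; apply: fin_add_prob_avg => k kn; have [] := hP (n, k) kn.
exists Q => // x; apply: QE.
have sumP n : \sum_(0 <= k < n.+1) P (n, k) [set z | (z <= x)%O] =
    \sum_(0 <= k < n.+1) (k%:R < F x * n.+1%:R)%R%:R.
  by apply: eq_big_nat => k /= kn; have [_ ->] := hP (n, k) kn.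
have bounds n := @sum_lt_bounds n.+1 (F x * n.+1%:R).
(* The number of k counted lies between (n+1) F x and (n+1) F x + 1, so the average exceeds F x by
   at most 1/(n+1), which is [harmonic n]. *)
apply: (@squeeze_cvgr _ _ _ _ (fun=> F x) (fun n => F x + harmonic n)).
- apply: nearW => n /=; rewrite sumP.
  rewrite [_^-1 * _]mulrC ler_pdivlMr// ler_pdivrMr// mulrDl.
  rewrite mulVf ?pnatr_eq0//; apply: bounds.
  have /andP[F0 F1] := F01 x; rewrite mulr_ge0//=.
  by rewrite ler_piMl.
- exact: cvg_cst.
- rewrite -[X in _ --> X]addr0; apply: cvgD; first exact: cvg_cst.
  exact: cvg_harmonic.
Qed.


(** * Bounds in the complete preorder, and immediate neighbours *)

Lemma order_complete_sup (A : set T) : order_complete (pquot T) ->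
  exists y : T, (forall x, A x -> (x <= y)%O) /\
    forall u, (forall x, A x -> (x <= u)%O) -> (y <= u)%O.
Proof.
move=> /(_ [set \pi_(pquot T)%qT x | x in A]) [[a [ubA lubA]] _].
exists (repr a); rewrite -(reprK a) in ubA lubA; split=> [x Ax|u Au].
  by rewrite -pquot_leE; apply: ubA; exists x.
by rewrite -pquot_leE; apply: lubA => _ [x Ax <-]; rewrite pquot_leE; exact: Au.
Qed.

Lemma order_complete_inf (A : set T) : order_complete (pquot T) ->
  exists y : T, (forall x, A x -> (y <= x)%O) /\
    forall u, (forall x, A x -> (u <= x)%O) -> (u <= y)%O.
Proof.
move=> /(_ [set \pi_(pquot T)%qT x | x in A]) [_ [a [lbA glbA]]].
exists (repr a); rewrite -(reprK a) in lbA glbA; split=> [x Ax|u Au].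
  by rewrite -pquot_leE; apply: lbA; exists x.
by rewrite -pquot_leE; apply: glbA => _ [x Ax <-]; rewrite pquot_leE; exact: Au.
Qed.

Lemma no_immediate_pred (y : T) : ~ has_immediate_pred y ->
  (exists z, (z < y)%O) /\
  forall z, (z < y)%O -> exists2 w, (z < w)%O & (w < y)%O.
Proof.
move=> npred; split=> [|z zy].
  apply: contrapT => nz; apply: npred; exists None; split.
    exact: adjoin_bot_lt0x.
  by case=> -[z|] []//; rewrite adjoin_bot_ltE => _ zy; apply: nz; exists z.
apply: contrapT => nw; apply: npred; exists (Some z); split.
  by rewrite adjoin_bot_ltE.
case=> -[w|] []//; rewrite !adjoin_bot_ltE => zw wy.
by apply: nw; exists w.
Qed.

Lemma no_immediate_succ (y z : T) : ~ has_immediate_succ y ->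
  (y < z)%O -> exists2 w, (y < w)%O & (w < z)%O.
Proof.
move=> nsucc yz; apply: contrapT => nw; apply: nsucc; exists z; split=> //.
by case=> w [yw wz]; apply: nw; exists w.
Qed.

Lemma lub_lt (A : set T) (y z : T) :
    (forall u, (forall x, A x -> (x <= u)%O) -> (y <= u)%O) ->
  (z < y)%O -> exists2 a, A a & (z < a)%O.
Proof.
move=> lub; rewrite total_ltNge => /negP nyz; apply: contrapT => na.
apply/nyz/lub => x Ax; rewrite -[(x <= z)%O]negbK -total_ltNge.
by apply/negP => zx; apply: na; exists x.
Qed.

Lemma glb_lt (A : set T) (y z : T) :
    (forall u, (forall x, A x -> (u <= x)%O) -> (u <= y)%O) ->
  (y < z)%O -> exists2 a, A a & (a < z)%O.
Proof.
move=> glb; rewrite total_ltNge => /negP nyz; apply: contrapT => na.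
apply/nyz/glb => x Ax; rewrite -[(z <= x)%O]negbK -total_ltNge.
by apply/negP => zx; apply: na; exists x.
Qed.

(** Members of [A] come strictly between an unattained supremum and anything below it; nonemptiness
    of [A] rules out the adjoined bottom as immediate predecessor. *)
Lemma lub_no_immediate_pred (A : set T) (y : T) : A !=set0 ->
    (forall x, A x -> (x < y)%O) ->
    (forall u, (forall x, A x -> (x <= u)%O) -> (y <= u)%O) ->
  ~ has_immediate_pred y.
Proof.
move=> [a Aa] ub lub [[z|] [zy]]; apply.
  rewrite adjoin_bot_ltE in zy.
  have [b Ab zb] := lub_lt lub zy.
  by exists (Some b); rewrite !adjoin_bot_ltE ub.
by exists (Some a); rewrite adjoin_bot_lt0x adjoin_bot_ltE ub.
Qed.

Lemma glb_no_immediate_succ (A : set T) (y : T) :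
    (forall x, A x -> (y < x)%O) ->
    (forall u, (forall x, A x -> (u <= x)%O) -> (u <= y)%O) ->
  ~ has_immediate_succ y.
Proof.
move=> lb glb [z [yz]]; apply.
by have [b Ab bz] := glb_lt glb yz; exists b; rewrite lb.
Qed.

(** A point mass at y-: it has the distribution function of the Dirac mass at [y], yet lives on the
    points strictly below [y]. It comes from an ultrafilter containing all intervals [w, y). *)
Lemma fin_add_prob_left (y : T) : ~ has_immediate_pred y ->
  exists2 P : set T -> R, fin_add_prob P &
    P [set z | (z < y)%O] = 1 /\
    forall x, P [set z | (z <= x)%O] = (y <= x)%O%:R.
Proof.
move=> /no_immediate_pred[y0 between].
have [||||P hP PD] := @fin_add_prob_tail (<=%O : rel T) [set z | (z < y)%O].
- exact: y0.
- exact: lexx.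
- by move=> b a c; exact: le_trans.
- exact: le_total.
have Ple1 A := fin_add_prob_le1 A hP; have [Pge0 _ _] := hP.
have Py : P [set z | (z < y)%O] = 1.
  have [a ay] := y0; apply/le_anti; rewrite Ple1/= -(PD a)//.
  by apply: fin_add_prob_le => // z [].
exists P => //; split=> // x; case: (boolP (y <= x)%O) => yx /=.
  apply/le_anti; rewrite Ple1/= -Py; apply: fin_add_prob_le => // z zy.
  by apply: le_trans yx; exact: ltW.
(* A point [w] strictly between [x] and [y] separates [0, x] from the tail [w, y), which has full
   mass. *)
rewrite -total_ltNge in yx; have [w xw wy] := between x yx.
apply/le_anti; rewrite Pge0 andbT.
suff : 1 <= P (~` [set z | (z <= x)%O]) by rewrite fin_add_probC//; lra.
rewrite -(PD w)//; apply: fin_add_prob_le => // z [_ /= wz] zx.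
by move: xw; rewrite total_ltNge (le_trans wz zx).
Qed.

(** * One-sided limits of distribution functions *)

Implicit Types F : T -> R.

Lemma cdf_left_ge F (y z : T) : is_cdf F -> (z < y)%O -> F z <= cdf_left F y.
Proof.
move=> [F01 _ _] zy; apply: ub_le_sup; last first.
  by exists (Some z) => //=; rewrite adjoin_bot_ltE.
by exists 1 => _ [[w|] _ <-] //=; case/andP: (F01 w).
Qed.

Lemma cdf_left_le F (y : T) (c : R) : 0 <= c ->
  (forall z, (z < y)%O -> F z <= c) -> cdf_left F y <= c.
Proof.
move=> c0 Fc; apply: ge_sup.
  (* The adjoined bottom contributes the value 0, so the supremum is over a nonempty set even for a
     least [y]. *)
  by exists 0; exists None => //=; exact: adjoin_bot_lt0x.
by move=> _ [[w|] /= wy <-] //; apply: Fc; rewrite -adjoin_bot_ltE.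
Qed.

Lemma cdf_left01 F (y : T) : is_cdf F -> 0 <= cdf_left F y <= 1.
Proof.
move=> [F01 _ _].
rewrite cdf_left_le ?andbT// => [|z _]; last by case/andP: (F01 z).
apply: ub_le_sup; last by exists None => //=; exact: adjoin_bot_lt0x.
by exists 1 => _ [[w|] _ <-] //=; case/andP: (F01 w).
Qed.

Lemma cdf_right_le F (y z : T) : is_cdf F -> (y < z)%O -> cdf_right F y <= F z.
Proof.
move=> [F01 _ _] yz.
rewrite /cdf_right; case: pselect => [ex|[]]; last by exists z.
apply: ge_inf; last by exists z.
by exists 0 => _ [w _ <-]; case/andP: (F01 w).
Qed.

Lemma cdf_right_ge F (y : T) (c : R) : c <= 1 ->
  (forall z, (y < z)%O -> c <= F z) -> c <= cdf_right F y.
Proof.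
move=> c1 Fc; rewrite /cdf_right; case: pselect => [[z yz]|//].
apply: lb_le_inf; first by exists (F z); exists z.
by move=> _ [w yw <-]; exact: Fc.
Qed.

(** * General bounds on the natural extension *)

Section pbox.
Context (Fl Fu : T -> R).
Context (pbox : is_pbox Fl Fu).
Notation upE := (natural_ext Fl Fu).

Lemma credal_cdf F : is_cdf F -> (forall x, Fl x <= F x <= Fu x) ->
  exists2 P, credal_set Fl Fu P & forall x, P [set z | (z <= x)%O] = F x.
Proof.
move=> hF FlFu; have [P hP PF] := fin_add_prob_cdf hF.
by exists P => //; split=> // x; rewrite PF.
Qed.

Lemma credal_set_neq0 : credal_set Fl Fu !=set0.
Proof.
have [hFl _ le] := pbox; have [|P hP _] := credal_cdf hFl; last by exists P.
by move=> x; rewrite lexx le.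
Qed.

Lemma natural_ext_ge P A : credal_set Fl Fu P -> P A <= upE A.
Proof.
move=> hP; apply: ub_le_sup; last by exists P.
by exists 1 => _ [Q [hQ _] <-]; exact: fin_add_prob_le1.
Qed.

Lemma natural_ext_le A (c : R) :
  (forall P, credal_set Fl Fu P -> P A <= c) -> upE A <= c.
Proof.
move=> Pc; apply: ge_sup; last by move=> _ [P hP <-]; exact: Pc.
by have [P hP] := credal_set_neq0; exists (P A); exists P.
Qed.

Lemma natural_ext01 A : 0 <= upE A <= 1.
Proof.
rewrite natural_ext_le ?andbT; last by move=> P [hP _]; exact: fin_add_prob_le1.
have [P hP] := credal_set_neq0.
by apply: le_trans (natural_ext_ge A hP); case: hP => -[].
Qed.

Lemma natural_ext_mono A B : A `<=` B -> upE A <= upE B.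
Proof.
move=> AB; apply: natural_ext_le => P hP.
apply: le_trans (natural_ext_ge B hP); apply: fin_add_prob_le => //.
by case: hP.
Qed.

Lemma credal_le_up P A x : credal_set Fl Fu P ->
  (forall z, A z -> (x < z)%O) -> P A <= 1 - Fl x.
Proof.
move=> [hP PF] Ax; have /andP[FlP _] := PF x.
apply: (@le_trans _ _ (P (~` [set z | (z <= x)%O]))).
  apply: fin_add_prob_le => // z /Ax; rewrite total_ltNge => /negP h //.
by rewrite fin_add_probC//; lra.
Qed.

Lemma natural_ext_le_down A x : (forall z, A z -> (z <= x)%O) -> upE A <= Fu x.
Proof.
move=> Ax; apply: natural_ext_le => P [hP PF]; have /andP[_ ] := PF x.
by apply: le_trans; exact: fin_add_prob_le.
Qed.

Lemma natural_ext_le_up A x : (forall z, A z -> (x < z)%O) -> upE A <= 1 - Fl x.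
Proof. by move=> Ax; apply: natural_ext_le => P hP; exact: credal_le_up. Qed.

Lemma natural_ext_le_sup A x : A x ->
  upE [set x] <= sup [set upE [set x] | x in A].
Proof.
move=> Ax; apply: ub_le_sup; last by exists x.
by exists 1 => _ [z _ <-]; case/andP: (natural_ext01 [set z]).
Qed.

(** The test used for every necessity claim: a suitable [P] in the credal set is played against a
    uniform bound on singletons. *)
Lemma possibility_bound P A (c : R) : is_possibility_measure Fl Fu ->
    credal_set Fl Fu P -> A !=set0 ->
  (forall x, A x -> upE [set x] <= c) -> P A <= c.
Proof.
move=> poss hP [x Ax] Ac; rewrite (le_trans (natural_ext_ge A hP))// poss.
apply: ge_sup; first by exists (upE [set x]); exists x.
by move=> _ [z Az <-]; exact: Ac.
Qed.

(** The other inequality is monotonicity, and the empty set has probability 0, which matches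
    [sup set0 = 0]. *)
Lemma is_possibility_measureI :
    (forall A, A !=set0 -> upE A <= sup [set upE [set x] | x in A]) ->
  is_possibility_measure Fl Fu.
Proof.
move=> le_sup A; have [->|/set0P A0] := eqVneq A set0.
  rewrite image_set0 sup0; apply/le_anti.
  have [-> _] := andP (natural_ext01 set0); rewrite andbT.
  by apply: natural_ext_le => P [/fin_add_prob0->].
apply/le_anti; rewrite le_sup//=; have [x Ax] := A0.
apply: ge_sup; first by exists (upE [set x]); exists x.
by move=> _ [z Az <-]; apply: natural_ext_mono => _ ->.
Qed.

Context (complete : order_complete (pquot T)).

(** * Sufficiency of (L1)-(L3) *)

Section sufficiency_lower.
Context (m : T).
Context (Fl_step : forall x, Fl x = (m <= x)%O%:R).

Lemma natural_ext_set1_ge_cdf z : (z <= m)%O -> Fu z <= upE [set z].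
Proof.
move=> zm; have [_ [Fu01 Fu_le _] FlFu] := pbox.
(* Mass [Fu z] at [z] and the rest at [m]: the distribution function is 0 before [z], [Fu z] on [z,
   m) and 1 from [m] on, hence within the p-box. *)
have zmP := fin_add_prob_mix (Fu01 z)
  (fin_add_prob_dirac z) (fin_add_prob_dirac m).
apply: le_trans (natural_ext_ge _ _); last first.
  split; [exact: zmP|] => x /=.
  have := FlFu x; rewrite !asboolb Fl_step.
  have [mx|_] := boolP (m <= x)%O.
    by rewrite (le_trans zm mx) /= !mulr1 => Fux; apply/andP; split; lra.
  have /andP[Fuz _] := Fu01 z.
  case: (boolP (z <= x)%O) => [zx|_] /= Fux; last by apply/andP; split; lra.
  by have := Fu_le _ _ zx; move=> Fuzx; apply/andP; split; lra.
rewrite /= asboolT// mulr1 lerDl mulr_ge0 ?ler0n//.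
by have /andP[_] := Fu01 z; lra.
Qed.

Lemma possibility_of_lower :
    (forall x : T, ~ has_immediate_pred x -> Fu x = cdf_left Fu x) ->
  is_possibility_measure Fl Fu.
Proof.
move=> Fu_left; have [_ [Fu01 Fu_le _] FlFu] := pbox.
apply: is_possibility_measureI => A [x0 Ax0].
set s := sup _.
have Flm : Fl m = 1 by rewrite Fl_step lexx.
have s0 : 0 <= s.
  apply: le_trans (natural_ext_le_sup Ax0).
  by case/andP: (natural_ext01 [set x0]).
have FuA a : A a -> (a <= m)%O -> Fu a <= s.
  move=> Aa am; apply: le_trans (natural_ext_le_sup Aa).
  exact: natural_ext_set1_ge_cdf.
pose A0 := A `&` [set z | (z <= m)%O].
have [y [uby luby]] := order_complete_sup A0 complete.
have [A00|A00] := pselect (A0 !=set0); last first.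
  (* All of [A] lies above [m], where the upper probability is at most 1 - Fl m = 0. *)
  have := @natural_ext_le_up A m; rewrite Flm subrr => h.
  apply: le_trans s0; apply: h => z Az; rewrite total_ltNge.
  by apply/negP => zm; apply: A00; exists z.
apply: (@le_trans _ _ (Fu y)).
  apply: natural_ext_le => P [hP PF].
  (* The second set is null because [Fl m = 1], and the first has probability at most [Fu y]. *)
  have AA0 : A `<=` [set z | (z <= y)%O] `|` ~` [set z | (z <= m)%O].
    move=> z Az; have [zm|zm] := pselect (z <= m)%O; last by right.
    by left; exact: uby.
  have := fin_add_prob_leD hP AA0; rewrite fin_add_probC//.
  by have /andP[_ ] := PF y; have /andP[] := PF m; rewrite Flm; lra.
have [[a [Aa am] ya]|noa] := pselect (exists2 a, A0 a & (y <= a)%O).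
  by rewrite (le_trans (Fu_le _ _ ya))// FuA.
(* The supremum [y] is not attained, so it has no immediate predecessor and [Fu y] is approached by
   values of [Fu] on [A0]. *)
rewrite Fu_left; last first.
  apply: lub_no_immediate_pred A00 _ luby => a Aa.
  by rewrite total_ltNge; apply/negP => ya; apply: noa; exists a.
apply: cdf_left_le => // z zy; have [a [Aa am] za] := lub_lt luby zy.
by rewrite (le_trans (Fu_le _ _ (ltW za)))// FuA.
Qed.

End sufficiency_lower.

(** * Sufficiency of (U1)-(U3) *)

Section sufficiency_upper.
Context (Fu01 : zero_one_valued Fu).
Context (Fu0max : has_maximum [set x : adjoin_bot T | cdf_ext Fu x = 0]).

(** By (U3) the set is empty or contained in one interval [0, n] with [Fu n = 0]. Finite additivity
    alone would not make an increasing union of null intervals null. *)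
Lemma credal_set_null P : credal_set Fl Fu P -> P [set z | Fu z = 0] = 0.
Proof.
move=> [hP PF]; have [Pge0 _ _] := hP; apply/le_anti; rewrite Pge0 andbT.
have [[n|] /= Fun nmax] := Fu0max.
  apply: (@le_trans _ _ (P [set z | (z <= n)%O])).
    by apply: fin_add_prob_le => // z Fuz; exact: (nmax (Some z)).
  by have /andP[_] := PF n; rewrite Fun.
suff -> : [set z | Fu z = 0] = set0 by rewrite fin_add_prob0.
by apply/seteqP; split=> // z /(nmax (Some z)).
Qed.

Lemma natural_ext_set1_ge x (c : R) : Fu x = 1 -> 0 <= c <= 1 ->
  (forall z, (z < x)%O -> Fl z <= c) -> 1 - c <= upE [set x].
Proof.
move=> Fux c01 Flc; have [[Fl01 _ _] hFu FlFu] := pbox.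
have [P hP PF] := fin_add_prob_cdf hFu.
have [_ Fu_le _] := hFu; have /andP[c0 c1] := c01.
(* With [P] of distribution function [Fu], the mixture has distribution function c Fu below [x] and
   1 from [x] on. Below [x] it dominates [Fl]: where [Fu] is 0 so is [Fl], and elsewhere [Fl] is at
   most c. *)
have hQ := fin_add_prob_mix c01 hP (fin_add_prob_dirac x).
apply: le_trans (natural_ext_ge _ _); last first.
  split; [exact: hQ|] => z /=; rewrite PF asboolb.
  have := FlFu z; have /andP[_ Fl1] := Fl01 z.
  have [xz|] := boolP (x <= z)%O.
    have := Fu_le _ _ xz; rewrite Fux => Fuz1 FlFuz.
    have Fuz : Fu z = 1.
      by case: (Fu01 z) => // Fuz; move: Fuz1; rewrite Fuz; lra.
    by rewrite Fuz /=; apply/andP; split; lra.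
  rewrite -total_ltNge => /Flc Flzc.
  by case: (Fu01 z) => -> FlFuz /=; apply/andP; split; lra.
by rewrite /= asboolT// mulr1 lerDr mulr_ge0//; case: hP.
Qed.

Lemma possibility_of_upper :
    (forall x : T, ~ has_immediate_succ x -> Fl x = cdf_right Fl x) ->
  is_possibility_measure Fl Fu.
Proof.
move=> Fl_right; have [hFl _ FlFu] := pbox; have [Fl01 Fl_le _] := hFl.
apply: is_possibility_measureI => A [x0 Ax0].
set s := sup _.
have s0 : 0 <= s.
  apply: le_trans (natural_ext_le_sup Ax0).
  by case/andP: (natural_ext01 [set x0]).
pose A0 := A `&` [set z | Fu z = 1].
have s_ge a c : A0 a -> 0 <= c <= 1 -> (forall z, (z < a)%O -> Fl z <= c) ->
    1 - c <= s.
  move=> [Aa Fua] c01 Flc; apply: le_trans (natural_ext_le_sup Aa).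
  exact: natural_ext_set1_ge.
have [y [lby glby]] := order_complete_inf A0 complete.
(* Outside [A0], the set [A] lies in the null set {Fu = 0}. *)
have PA_le P B : credal_set Fl Fu P -> A0 `<=` B -> P A <= P B.
  move=> hP A0B; have [hP' _] := hP.
  rewrite -[P B]add0r -(credal_set_null hP); apply: fin_add_prob_leD => // z Az.
  by case: (Fu01 z) => Fuz; [left|right; apply: A0B].
apply: natural_ext_le => P hP; have [hP' PF] := hP.
have [A00|A00] := pselect (A0 !=set0); last first.
  apply: le_trans s0; rewrite -(fin_add_prob0 hP'); apply: PA_le => // z A0z.
  by case: A00; exists z.
have PA_lt z : (forall a, A0 a -> (z < a)%O) -> P A <= 1 - Fl z.
  move=> zA; apply: le_trans (PA_le P _ hP (@subset_refl _ A0)) _.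
  exact: credal_le_up.
have [[a A0a ay]|noa] := pselect (exists2 a, A0 a & (a <= y)%O).
  (* The infimum is attained at [a]. The singleton of [a] reaches 1 - Fl(a-), and [P A] is at most 1
     - Fl z for every z below [a]. *)
  apply: le_trans (s_ge a (cdf_left Fl a) A0a (cdf_left01 a hFl) _); last first.
    by move=> z; exact: cdf_left_ge.
  suff : cdf_left Fl a <= 1 - P A by lra.
  apply: cdf_left_le; first by rewrite subr_ge0 fin_add_prob_le1.
  move=> z za; suff : P A <= 1 - Fl z by lra.
  apply: PA_lt => b A0b; apply: (lt_le_trans za).
  exact: le_trans ay (lby _ A0b).
have yA a : A0 a -> (y < a)%O.
  by move=> A0a; rewrite total_ltNge; apply/negP => ay; apply: noa; exists a.
apply: le_trans (PA_lt y yA) _.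
(* The infimum is not attained: (U2) turns 1 - Fl y into 1 - Fl(y+), and each z above [y] has a
   point of [A0] below it, whose singleton reaches at least 1 - Fl z. *)
rewrite Fl_right; last exact: glb_no_immediate_succ yA glby.
suff : 1 - s <= cdf_right Fl y by lra.
apply: cdf_right_ge => [|z yz]; first by lra.
have [a A0a az] := glb_lt glby yz.
suff : 1 - Fl z <= s by lra.
by apply: (s_ge a) => // w wa; apply: Fl_le; exact: ltW (lt_trans wa az).
Qed.

End sufficiency_upper.

(** * Necessity *)

Section necessity.
Context (poss : is_possibility_measure Fl Fu).

(** The test set is the whole space cut at [x]: its probability 1 is bounded by the larger of Fu x
    and 1 - Fl x. *)
Lemma possibility_Fu1_or_Fl0 x : Fu x = 1 \/ Fl x = 0.
Proof.
have [[Fl01 _ _] [Fu01 _ _] _] := pbox.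
have /andP[Fl0 _] := Fl01 x; have /andP[_ Fu1] := Fu01 x.
have [P hP] := credal_set_neq0.
have : P setT <= Num.max (Fu x) (1 - Fl x).
  apply: (possibility_bound poss hP); first by exists x.
  move=> z _; rewrite le_max; apply/orP; case: (boolP (z <= x)%O) => zx.
    by left; apply: natural_ext_le_down => _ ->.
  by right; apply: natural_ext_le_up => _ ->; rewrite total_ltNge.
have [[_ -> _] _] := hP; rewrite le_max => /orP[h|h]; [left|right]; lra.
Qed.

Lemma possibility_zero_one : zero_one_valued Fl \/ zero_one_valued Fu.
Proof.
have [[Fl01 Fl_le Fl1] [Fu01 Fu_le Fu1] FlFu] := pbox.
apply: contrapT => /not_orP[/existsNP[x /not_orP[Flx0 Flx1]]].
move=> /existsNP[y /not_orP[Fuy0 Fuy1]].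
have /andP[Flx_ge0 Flx_le1] := Fl01 x; have /andP[Fuy_ge0 Fuy_le1] := Fu01 y.
have Fux : Fu x = 1 by case: (possibility_Fu1_or_Fl0 x).
have Fly : Fl y = 0 by case: (possibility_Fu1_or_Fl0 y).
have {}Flx0 : 0 < Fl x by rewrite lt_neqAle eq_sym Flx_ge0 andbT; apply/eqP.
have {}Flx1 : Fl x < 1 by rewrite lt_neqAle Flx_le1 andbT; apply/eqP.
have {}Fuy0 : 0 < Fu y by rewrite lt_neqAle eq_sym Fuy_ge0 andbT; apply/eqP.
have {}Fuy1 : Fu y < 1 by rewrite lt_neqAle Fuy_le1 andbT; apply/eqP.
have yx : (y <= x)%O.
  by apply: ltW; rewrite total_ltNge; apply/negP => /Fl_le; lra.
pose p := Num.min (Fu y) (Fl x).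
have p01 : 0 < p /\ p <= Fl x by rewrite lt_min ge_min Fuy0 Flx0 lexx orbT.
have [p0 px] := p01.
(* [F] raises [Fl] towards level [p] as far as [Fu] allows. Since [p] is at most both [Fu y] and
   [Fl x], it gives F y = p without raising F x above [Fl x]. *)
pose F z := Num.max (Fl z) (Num.min (Fu z) p).
have FlF z : Fl z <= F z <= Fu z.
  by rewrite /F le_max lexx ge_max FlFu ge_min lexx.
have hF : is_cdf F.
  split=> [z|z w zw|].
  - have /andP[FlFz FzFu] := FlF z; have /andP[Flz _] := Fl01 z.
    by have /andP[_ Fuz] := Fu01 z; apply/andP; split; lra.
  - by rewrite le_max2 ?le_min2 ?Fl_le ?Fu_le.
  - have /andP[] := FlF \top%O; rewrite Fl1 Fu1 => *; lra.
have [P hP PF] := credal_cdf hF FlF.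
have Fy : F y = p.
  rewrite /F Fly (min_idPr _) ?(max_idPr _)//; first exact: ltW.
  by rewrite ge_min lexx.
have Fx : F x = Fl x.
  by rewrite /F Fux; apply/max_idPl; rewrite ge_min px orbT.
pose A := [set z | (z <= y)%O] `|` ~` [set z | (z <= x)%O].
have PA : P A = p + (1 - Fl x).
  have [hP' _] := hP; have [_ _ ->] := hP'.
    by rewrite fin_add_probC// !PF Fy Fx.
  by apply/seteqP; split=> // z [zy]; apply; exact: le_trans zy yx.
have : P A <= Num.max (Fu y) (1 - Fl x).
  apply: (possibility_bound poss hP); first by exists y; left => /=.
  move=> z [zy|zx]; rewrite le_max; apply/orP.
    by left; apply: natural_ext_le_down => _ ->.
  by right; apply: natural_ext_le_up => _ ->; rewrite total_ltNge; exact/negP.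
(* The sum p + 1 - Fl x strictly exceeds both terms of the maximum: it equals Fu y + 1 - Fl x if p =
   Fu y, and 1 if p = Fl x. *)
rewrite PA le_max /p; case: (leP (Fu y) (Fl x)) => h /orP[]; lra.
Qed.

(** A charge with distribution function [Fl] gives (x, 1] mass 1 - Fl x. Each w above [x] leaves
    room for some v strictly between, so its singleton has upper probability at most 1 - Fl v, hence
    at most 1 - Fl(x+). *)
Lemma possibility_right x : ~ has_immediate_succ x -> Fl x = cdf_right Fl x.
Proof.
move=> nsucc; have [hFl _ FlFu] := pbox; have [Fl01 Fl_le Fl1] := hFl.
apply/le_anti/andP; split.
  by apply: cdf_right_ge => [|z /ltW/Fl_le//]; case/andP: (Fl01 x).
have [[z xz]|nz] := pselect (exists z, (x < z)%O); last first.
  suff -> : Fl x = 1.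
    by rewrite /cdf_right; case: pselect.
  apply/le_anti; have /andP[_ ->] := Fl01 x; rewrite -Fl1 Fl_le//=.
  rewrite -[(_ <= _)%O]negbK -total_ltNge; apply/negP => xt.
  by apply: nz; exists \top%O.
have [|P hP PF] := credal_cdf hFl; first by move=> w; rewrite lexx FlFu.
have : P (~` [set z | (z <= x)%O]) <= 1 - cdf_right Fl x.
  apply: (possibility_bound poss hP).
    by exists z => /=; apply/negP; rewrite -total_ltNge.
  move=> w /= /negP; rewrite -total_ltNge => xw.
  have [v xv vw] := no_immediate_succ nsucc xw.
  apply: (@le_trans _ _ (1 - Fl v)); first by apply: natural_ext_le_up => _ ->.
  by rewrite lerD2l lerN2 cdf_right_le.
by rewrite fin_add_probC ?PF; [lra|case: hP].
Qed.

(** Take [m] as the infimum of {Fl = 1}. If it were not attained, [m] would have no immediate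
    successor, and [possibility_right] would give Fl m = Fl(m+) = 1. *)
Lemma possibility_lower : zero_one_valued Fl ->
  exists m, forall x, Fl x = (m <= x)%O%:R.
Proof.
move=> zo; have [[_ Fl_le Fl1] _ _] := pbox.
have [m [lbm glbm]] := order_complete_inf [set x | Fl x = 1] complete.
suff Flm : Fl m = 1.
  exists m => x; case: (boolP (m <= x)%O) => [mx|nmx].
    have [Flx|//] := zo x; have := Fl_le _ _ mx; rewrite Flm Flx; lra.
  by case: (zo x) => // /lbm mx; rewrite mx in nmx.
have [Flm0|//] := zo m.
have ltm x : Fl x = 1 -> (m < x)%O.
  move=> Flx; rewrite total_ltNge; apply/negP => /Fl_le; rewrite Flx Flm0; lra.
have nsucc := glb_no_immediate_succ ltm glbm.
rewrite possibility_right//; apply/le_anti/andP; split.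
  by rewrite (le_trans (cdf_right_le _ (ltm _ Fl1))) ?Fl1//; case: pbox.
apply: cdf_right_ge => // z mz; have [a Fla az] := glb_lt glbm mz.
by rewrite -Fla; apply: Fl_le; exact: ltW.
Qed.

Lemma possibility_left m : (forall x, Fl x = (m <= x)%O%:R) ->
  forall x, ~ has_immediate_pred x -> Fu x = cdf_left Fu x.
Proof.
move=> Fl_step y npred; have [_ hFu FlFu] := pbox.
have [Fu01 Fu_le _] := hFu; have /andP[left0 left1] := cdf_left01 y hFu.
apply/le_anti/andP; split; last first.
  by apply: cdf_left_le => [|z /ltW/Fu_le//]; case/andP: (Fu01 y).
have [[z0 z0y] _] := no_immediate_pred npred.
have [P hP [Py PF]] := fin_add_prob_left npred.
(* Mass [Fu y] at y- and the rest at [m]: the points strictly below [y] get at least [Fu y], while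
   their singletons have upper probability at most Fu(y-). *)
have hQ := fin_add_prob_mix (Fu01 y) hP (fin_add_prob_dirac m).
have credalQ : (y <= m)%O ->
    credal_set Fl Fu (fun A => Fu y * P A + (1 - Fu y) * (`[< A m >])%:R).
  move=> ym; split=> // x; rewrite PF asboolb Fl_step.
  have := FlFu x; rewrite Fl_step; have /andP[Fuy0 Fuy1] := Fu01 y.
  have [mx|_] := boolP (m <= x)%O.
    by rewrite (le_trans ym mx) => /= ?; apply/andP; split; lra.
  have [yx|_] := boolP (y <= x)%O.
    by have := Fu_le _ _ yx => /= *; apply/andP; split; lra.
  by move=> /= ?; apply/andP; split; lra.
have [ym|ny] := boolP (y <= m)%O; last first.
  (* If m lies below [y], then Fu(y-) is at least Fu m, which is 1. *)
  have /(cdf_left_ge hFu) : (m < y)%O by rewrite total_ltNge.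
  have := FlFu m; rewrite Fl_step lexx.
  by have /andP[_] := Fu01 y; rewrite /=; lra.
apply: le_trans
  (possibility_bound (A := [set z | (z < y)%O]) poss (credalQ ym) _ _).
- by rewrite Py mulr1 lerDl mulr_ge0 ?ler0n//; have /andP[_] := Fu01 y; lra.
- by exists z0.
- move=> z zy; apply: le_trans (cdf_left_ge hFu zy).
  by apply: natural_ext_le_down => _ ->.
Qed.

(** If the supremum [y] of {Fu = 0} were not attained, [Fu] would be the indicator of [y, 1]. The
    point mass at y- would then be in the credal set and charge only points whose singletons have
    upper probability 0. *)
Lemma possibility_upper : zero_one_valued Fu ->
  has_maximum [set x : adjoin_bot T | cdf_ext Fu x = 0].
Proof.
move=> zo; have [_ [_ Fu_le _] FlFu] := pbox.
have [[z0 Fuz0]|nz] := pselect (exists z, Fu z = 0); last first.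
  by exists None => // -[z|//] /= Fuz; case: nz; exists z.
have [y [uby luby]] := order_complete_sup [set x | Fu x = 0] complete.
have [Fuy|Fuy] := zo y.
  by exists (Some y) => // -[z|//] /uby.
have lty z : Fu z = 0 -> (z < y)%O.
  move=> Fuz; rewrite total_ltNge; apply/negP => /Fu_le; rewrite Fuz Fuy; lra.
have npred : ~ has_immediate_pred y.
  by apply: lub_no_immediate_pred lty luby; exists z0.
have FuE z : Fu z = (y <= z)%O%:R.
  case: (boolP (y <= z)%O) => [yz|].
    by have [Fuz|//] := zo z; have := Fu_le _ _ yz; rewrite Fuz Fuy; lra.
  rewrite -total_ltNge => zy; have [a Fua za] := lub_lt luby zy.
  by have [//|Fuz] := zo z; have := Fu_le _ _ (ltW za); rewrite Fuz Fua; lra.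
have [P hP [Py PF]] := fin_add_prob_left npred.
have credalP : credal_set Fl Fu P.
  by split=> // x; rewrite PF -FuE lexx FlFu.
have : P [set z | (z < y)%O] <= 0.
  apply: (possibility_bound poss credalP); first by exists z0; exact: lty.
  move=> z zy; apply: (@le_trans _ _ (Fu z)).
    by apply: natural_ext_le_down => _ ->.
  by rewrite FuE; move: zy; rewrite /= total_ltNge => /negbTE ->.
by rewrite Py; lra.
Qed.

End necessity.
End pbox.
End charge.

Theorem corollary17 (R : realType) (d : Order.disp_t) (Omega : tbPreorderType d)
    (le_total : total (<=%O : rel Omega))
    (complete : order_complete (pquot Omega))
    (Fl Fu : Omega -> R) (pbox : is_pbox Fl Fu) :
  is_possibility_measure Fl Fu <->
  [/\ zero_one_valued Fl,
      (forall x : Omega, ~ has_immediate_pred x -> Fu x = cdf_left Fu x) &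
      has_minimum [set x : adjoin_bot Omega | cdf_ext Fl x = 1]]
  \/
  [/\ zero_one_valued Fu,
      (forall x : Omega, ~ has_immediate_succ x -> Fl x = cdf_right Fl x) &
      has_maximum [set x : adjoin_bot Omega | cdf_ext Fu x = 0]].
Proof.
split=> [poss|[[Fl01 Fu_left]|[Fu01 Fl_right Fu0max]]]; last first.
- exact: possibility_of_upper.
(* The adjoined bottom has value 0, so the minimum in (L3) is a point [m] of the space, and [Fl] is
   the indicator of [m, 1]. *)
- case=> -[m|] /= Flm mmin; last by move/eqP: Flm; rewrite eq_sym oner_eq0.
  apply: (possibility_of_lower le_total pbox complete (m := m) _ Fu_left) => x.
  have [[_ Fl_le _] _ _] := pbox.
  case: (boolP (m <= x)%O) => [mx|nmx].
    by have [Flx|//] := Fl01 x; have := Fl_le _ _ mx; rewrite Flm Flx; lra.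
  by have [//|/(mmin (Some x)) mx] := Fl01 x; move/negP: nmx.
have [Fl01|Fu01] := possibility_zero_one le_total pbox poss.
  have [m Fl_step] := possibility_lower le_total pbox complete poss Fl01.
  left; split=> //.
    by move=> x; exact: (possibility_left le_total pbox poss Fl_step).
  exists (Some m) => [|[x|]] /=; first by rewrite Fl_step lexx.
    rewrite Fl_step => /eqP; rewrite pnatr_eq1 eqb1; exact.
  by move/eqP; rewrite eq_sym oner_eq0.
right; split=> //.
  by move=> x; exact: (possibility_right le_total pbox poss).
exact: (possibility_upper le_total pbox complete poss Fu01).
Qed.
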